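(* For every $q=q(n)$ with $q\le O(n^2)$, $$L(n,q)\asymp\frac{n\,2^n}{\log_2 n},$$ i.e. there are constants $0<c_1\le c_2$ such that $c_1\,n2^n/\log_2 n\le L(n,q(n))\le c_2\,n2^n/\log_2 n$ for all sufficiently large $n$.
   Context: For $m\ge1$, a $k$-CNOT gate on $m$ lines with control lines $i_1,\dots,i_k$ and target line $j\notin\{i_1,\dots,i_k\}$ is the map $\mathbb Z_2^m\to\mathbb Z_2^m$ replacing $x_j$ by $x_j\oplus(x_{i_1}\wedge\dots\wedge x_{i_k})$ and leaving other coordinates unchanged; NOT, CNOT, 2-CNOT are the cases $k=0,1,2$. A reversible circuit on $m$ lines is a finite sequence of such gates, computing their composition $g$; its complexity is its number of gates. With $\phi_{n,n+q}(\langle x_1,\dots,x_n\rangle)=\langle x_1,\dots,x_n,0,\dots,0\rangle\in\mathbb Z_2^{n+q}$ and $\psi_{n+q,n}(\langle x_1,\dots,x_{n+q}\rangle)=\langle x_1,\dots,x_n\rangle$, a circuit on $n+q$ lines implements $f\colon\mathbb Z_2^n\to\mathbb Z_2^n$ with $q$ additional inputs if $\psi_{n+q,n}(g(\phi_{n,n+q}(\vec x)))=f(\vec x)$ for all $\vec x$. $F(n,q)$ is the set of maps $\mathbb Z_2^n\to\mathbb Z_2^n$ implementable this way. The Shannon function $L(n,q)$ is the maximum, over all $f\in F(n,q)$, of the minimum complexity of a reversible circuit of NOT, CNOT, 2-CNOT gates implementing $f$ with $q$ additional inputs. *)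

(* Defs.v *)
From Stdlib Require Import Reals ClassicalEpsilon.
From mathcomp Require Import all_boot.
Set Implicit Arguments. Unset Strict Implicit. Unset Printing Implicit Defensive.

Definition vec (m : nat) := {ffun 'I_m -> bool}.

(* A gate on m lines: (set of control lines, target line). *)
Definition gate (m : nat) := ({set 'I_m} * 'I_m)%type.

(* Admissible gates: NOT, CNOT, 2-CNOT, i.e. k-CNOT with k <= 2 controls,
   target not among the controls. *)
Definition valid_gate (m : nat) (g : gate m) : bool :=
  (#|g.1| <= 2) && (g.2 \notin g.1).

Definition apply_gate (m : nat) (g : gate m) (x : vec m) : vec m :=
  [ffun i => if i == g.2 then xorb (x i) [forall c in g.1, x c] else x i].

Definition circuit (m : nat) := seq (gate m).

Definition run (m : nat) (c : circuit m) (x : vec m) : vec m :=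
  foldl (fun y g => apply_gate g y) x c.

Definition phi (n q : nat) (x : vec n) : vec (n + q) :=
  [ffun i => match split i with inl j => x j | inr _ => false end].

Definition psi (n q : nat) (y : vec (n + q)) : vec n :=
  [ffun j => y (lshift q j)].

Definition implements (n q : nat) (c : circuit (n + q)) (f : vec n -> vec n) : Prop :=
  all (@valid_gate (n + q)) c /\ forall x : vec n, @psi n q (run c (@phi n q x)) = f x.

Definition in_F (n q : nat) (f : vec n -> vec n) : Prop :=
  exists c : circuit (n + q), @implements n q c f.

Definition has_circuit_of_size (n q : nat) (f : vec n -> vec n) : pred nat :=
  fun k => if excluded_middle_informative
                (exists c : circuit (n + q), @implements n q c f /\ size c = k)
           then true else false.

(* Minimal complexity of a circuit implementing f with q additional inputs
   (0 by convention when f is not in F(n,q); such f are excluded below). *)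
Definition min_complexity (n q : nat) (f : {ffun vec n -> vec n}) : nat :=
  match excluded_middle_informative (exists k, @has_circuit_of_size n q f k) with
  | left h => ex_minn h
  | right _ => 0
  end.

Definition in_Fb (n q : nat) (f : {ffun vec n -> vec n}) : bool :=
  if excluded_middle_informative (@in_F n q f) then true else false.

Definition L (n q : nat) : nat :=
  \max_(f : {ffun vec n -> vec n} | @in_Fb n q f) @min_complexity n q f.

Definition log2R (x : R) : R := Rdiv (ln x) (ln (IZR 2)).

(* Main.v *)
(* Upper bound.  A permutation of the Boolean cube that moves many points can be
   multiplied by K disjoint transpositions so as to fix K more points, and for
   K = 2^k of order log n such a product of transpositions costs O(n) gates.  Indeed, the 2K points
   involved form a 2K-row Boolean matrix with at most 2^(2K) distinct columns, so
   CNOTs clear all but few lines on these points; the cleared lines then serve to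
   move the points onto a (k+1)-dimensional subcube, on which the product becomes a
   single NOT controlled by all the other lines.  A multiply controlled NOT needs
   O(n) gates and one spare line.  A permutation with O(K) moved points is treated
   two transpositions at a time, which requires it to be even; circuits on at
   least four lines compute even permutations, and with an additional input a
   partial injection always extends to an even permutation.  At most n of the
   additional inputs are needed.

   Lower bound.  All even permutations lie in F(n,q), and the number of circuits of
   size l on m lines is at most (m+1)^(3l). *)

Require Import Defs.
From Stdlib Require Import Reals ClassicalEpsilon Lra.
From mathcomp Require Import all_boot perm fingroup alt zify.
Set Implicit Arguments. Unset Strict Implicit. Unset Printing Implicit Defensive.

Local Open Scope nat_scope.

(** * Multiply controlled NOT gates *)

Definition toggle m (t : 'I_m) (b : vec m -> bool) (x : vec m) : vec m :=
  [ffun i => x i (+) ((i == t) && b x)].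

Lemma apply_gateE m (g : gate m) (x : vec m) :
  apply_gate g x = toggle g.2 (fun y => [forall c in g.1, y c]) x.
Proof.
apply/ffunP=> i; rewrite !ffunE; case: (i == g.2) => //=; last by rewrite addbF.
by case: (x i); case: [forall c in g.1, x c].
Qed.

Lemma toggle_neq m (t j : 'I_m) b x : j != t -> toggle t b x j = x j.
Proof. by move=> /negbTE ne; rewrite ffunE ne addbF. Qed.

Lemma apply_gateK m (g : gate m) : valid_gate g -> involutive (apply_gate g).
Proof.
move=> /andP[_ tS] x; rewrite !apply_gateE.
apply/ffunP=> i; rewrite [LHS]ffunE [toggle _ _ _ i]ffunE.
set b := [forall c in _, _]; set b' := [forall c in _, _].
suff -> : b = b' by rewrite -addbA addbb addbF.
apply: eq_forallb => c; case: (boolP (c \in g.1)) => //= cS.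
by rewrite toggle_neq //; apply: contraNneq tS => <-.
Qed.

Lemma run_cat m (c d : circuit m) x : run (c ++ d) x = run d (run c x).
Proof. exact: foldl_cat. Qed.

Lemma run_rcons m (c : circuit m) g x : run (rcons c g) x = apply_gate g (run c x).
Proof. by rewrite -cats1 run_cat. Qed.

Lemma run_rev m (c : circuit m) :
  all (@valid_gate m) c -> cancel (run c) (run (rev c)).
Proof.
elim: c => [|g c IH] //= /andP[vg vc] x.
by rewrite rev_cons run_rcons /= IH // apply_gateK.
Qed.

(** Agreement with [F] is required on every state of the [m] lines, so a borrowed line must be
    restored whatever it holds. *)
Definition realizable m N (F : vec m -> vec m) :=
  exists c : circuit m, [/\ all (@valid_gate m) c, size c <= N & run c =1 F].

Lemma realizable_mono m N N' (F : vec m -> vec m) :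
  N <= N' -> realizable N F -> realizable N' F.
Proof. by move=> le [c [vc sc rc]]; exists c; split=> //; apply: leq_trans le. Qed.

Lemma realizable_ext m N (F G : vec m -> vec m) :
  F =1 G -> realizable N F -> realizable N G.
Proof. by move=> FG [c [vc sc rc]]; exists c; split=> // x; rewrite rc FG. Qed.

Lemma realizable_id m N : realizable N (@id (vec m)).
Proof. by exists [::]. Qed.

Lemma realizable_comp m N1 N2 (F G : vec m -> vec m) :
  realizable N1 F -> realizable N2 G -> realizable (N1 + N2) (fun x => G (F x)).
Proof.
move=> [c [vc sc rc]] [d [vd sd rd]]; exists (c ++ d); split.
- by rewrite all_cat vc.
- by rewrite size_cat leq_add.
- by move=> x; rewrite run_cat rc rd.
Qed.

Lemma realizable_inv m N (F : vec m -> vec m) :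
  realizable N F -> exists G, [/\ cancel F G, cancel G F & realizable N G].
Proof.
move=> [c [vc sc rc]]; exists (run (rev c)); split.
- by move=> x; rewrite -rc run_rev.
- by move=> x; rewrite -rc -{1}(revK c) run_rev // all_rev.
- by exists (rev c); rewrite all_rev size_rev.
Qed.

Lemma realizable_gate m (S : {set 'I_m}) t :
  #|S| <= 2 -> t \notin S -> realizable 1 (toggle t (fun x => [forall c in S, x c])).
Proof.
move=> cS tS; exists [:: (S, t)]; split=> [|//|x].
- by rewrite /= /valid_gate /= cS tS.
- by rewrite /= apply_gateE.
Qed.

Lemma toggle_ext m (t : 'I_m) b b' : b =1 b' -> toggle t b =1 toggle t b'.
Proof. by move=> bb x; apply/ffunP=> i; rewrite !ffunE bb. Qed.

Lemma realizable_not m (t : 'I_m) : realizable 1 (toggle t xpredT).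
Proof.
apply: (@realizable_ext _ _ (toggle t (fun x => [forall c in set0, x c]))).
  by apply: toggle_ext => x; apply/forallP=> c; rewrite inE.
by apply: realizable_gate; rewrite ?cards0 ?inE.
Qed.

Lemma realizable_cnot m (c t : 'I_m) :
  c != t -> realizable 1 (toggle t (fun x => x c)).
Proof.
move=> ct; apply: (@realizable_ext _ _ (toggle t (fun x => [forall i in [set c], x i]))).
  apply: toggle_ext => x; apply/forallP/idP => [/(_ c)|xc i]; rewrite in_set1 ?eqxx //=.
  by apply/implyP=> /eqP->.
by apply: realizable_gate; rewrite ?cards1 // in_set1 eq_sym.
Qed.

Lemma realizable_toffoli m (c d t : 'I_m) :
  c != t -> d != t -> realizable 1 (toggle t (fun x => x c && x d)).
Proof.
move=> ct dt; apply: (@realizable_ext _ _ (toggle t (fun x => [forall i in [set c; d], x i]))).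
  apply: toggle_ext => x; apply/forallP/andP => [h|[xc xd] i].
    by split; [move: (h c)|move: (h d)]; rewrite !inE eqxx ?orbT.
  by rewrite !inE; apply/implyP=> /orP[]/eqP->.
by apply: realizable_gate; rewrite ?cards2 ?inE ?negb_or ?[t == _]eq_sym ?ct //; case: (c != d).
Qed.

(* The effect of the ladder on line [j]: if [ps] lists pairs (control, target)
   from the last rung down, the target of each rung is toggled by the
   conjunction of the controls of all rungs up to it. *)
Fixpoint ladder_effect m (ps : seq ('I_m * 'I_m)) (x : vec m) (j : 'I_m) : bool :=
  if ps is p :: ps' then
    ((j == p.2) && all (fun p' => x p'.1) ps) (+) ladder_effect ps' x j
  else false.

Lemma ladder_effect_notin m (ps : seq ('I_m * 'I_m)) x j :
  j \notin unzip2 ps -> ladder_effect ps x j = false.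
Proof.
elim: ps => //= p ps IH; rewrite inE negb_or => /andP[/negbTE-> jps].
by rewrite IH.
Qed.

Lemma ladder_effect_ext m (ps : seq ('I_m * 'I_m)) (x y : vec m) j :
  {in unzip1 ps, x =1 y} -> ladder_effect ps x j = ladder_effect ps y j.
Proof.
elim: ps => //= p ps IH h; rewrite IH; last by move=> i ips; apply: h; rewrite inE ips orbT.
congr (_ && (_ && _) (+) _); first by apply: h; rewrite inE eqxx.
by apply: eq_in_all => p' p'ps; apply: h; rewrite inE map_f // orbT.
Qed.

(** The shorter ladder is enclosed between two copies of a 2-CNOT from the new control and the
    previous target [a']. The two contributions of the old value of [a'] cancel, and what remains is
    the new control times the change of [a']. The first rung is a CNOT. *)
Lemma ladder_realizable m (ps : seq ('I_m * 'I_m)) :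
  uniq (unzip1 ps ++ unzip2 ps) ->
  realizable (2 * size ps) (fun x => [ffun j => x j (+) ladder_effect ps x j]).
Proof.
elim: ps => [_|[c a] ps IH].
  by apply: realizable_ext (realizable_id _ _) => x; apply/ffunP=> j; rewrite ffunE addbF.
rewrite /= cat_uniq /= negb_or mem_cat inE !negb_or.
case/and5P=> /and3P[c1 ca c2] u1 /andP[au hs] au2 u2.
have {}IH : realizable (2 * size ps) (fun x => [ffun j => x j (+) ladder_effect ps x j]).
  by apply: IH; rewrite cat_uniq u1 hs.
case: ps c1 c2 u1 au hs au2 u2 IH => [|[c' a'] ps].
  move=> *; apply: realizable_mono (realizable_ext _ (realizable_cnot ca)) => // x.
  by apply/ffunP=> j; rewrite !ffunE /= andbT addbF.
set qs := _ :: ps => c1 c2 u1 au hs au2 u2 IH.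
have a'a : a' != a by apply: contraNneq au2 => <-; rewrite /= inE eqxx.
have T := realizable_toffoli ca a'a.
apply: realizable_mono (realizable_ext _ (realizable_comp (realizable_comp T IH) T)).
  by rewrite /= ?szA ?szB; lia.
move=> x; apply/ffunP=> j; rewrite [LHS]ffunE ![in LHS]ffunE.
have ext y : ladder_effect qs (toggle a y x) =1 ladder_effect qs x.
  move=> i; apply: ladder_effect_ext => i' i'q; rewrite toggle_neq //.
  by apply: contraNneq au => <-.
rewrite !ext (negbTE ca) (negbTE a'a) !addbF.
rewrite [ladder_effect qs x c]ladder_effect_notin // addbF.
have ea' : ladder_effect qs x a' = all (fun p => x p.1) qs.
  rewrite [LHS]/= eqxx ladder_effect_notin ?addbF //.
  by move: u2; rewrite /qs /= => /andP[].
rewrite [RHS]ffunE ea'.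
move: (all _ qs) (ladder_effect qs x j) => al le.
by case: (j == a) (x j) (x c) (x a') al le => [] [] [] [] [] [].
Qed.

Lemma all_toggle m (s : seq 'I_m) t b (x : vec m) :
  t \notin s -> all (toggle t b x) s = all x s.
Proof.
move=> ts; apply: eq_in_all => i si; rewrite toggle_neq //.
by apply: contraNneq ts => <-.
Qed.

(** The lines [ds] may hold anything: a ladder ending in [t] is followed by the same ladder without
    its last rung, which undoes every change except the one on [t]. The extra gate in the bound pays
    for the NOT when [cs] is empty. *)
Lemma realizable_and_dirty m (cs ds : seq 'I_m) t :
  uniq (t :: cs ++ ds) -> size cs <= (size ds).+1 ->
  realizable (4 * size cs).+1 (toggle t (fun x => all x cs)).
Proof.
case: cs => [|c cs] ut le.
  by apply: realizable_ext (realizable_not t).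
pose ps := zip cs (take (size cs) ds).
have szd : size (take (size cs) ds) = size cs by rewrite size_takel.
have u1E : unzip1 ps = cs by rewrite unzip1_zip // szd.
have u2E : unzip2 ps = take (size cs) ds by rewrite unzip2_zip // szd.
have szE : size ps = size cs by rewrite size_zip szd minnn.
move: ut; rewrite /= !inE !mem_cat !negb_or => /and3P[/and3P[tc tcs td] /andP[ccs cd] ucd].
move: (ucd); rewrite cat_uniq => /and3P[ucs hcd ud].
have sub : {subset take (size cs) ds <= ds} by move=> i /mem_take.
have dis : ~~ has [in cs] (take (size cs) ds).
  by apply: contra hcd => /hasP[i /sub ids ics]; apply/hasP; exists i.
have U2 : uniq (unzip1 ps ++ unzip2 ps) by rewrite u1E u2E cat_uniq ucs dis take_uniq.
have U1 : uniq (unzip1 ((c, t) :: ps) ++ unzip2 ((c, t) :: ps)).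
  rewrite /= u1E u2E cat_uniq /= mem_cat inE !negb_or [c == t]eq_sym ccs ucs tc tcs dis.
  rewrite take_uniq // !andTb andbT; apply/andP; split; first by apply: contra cd => /sub.
  by apply: contra td => /sub.
apply: realizable_mono
  (realizable_ext _ (realizable_comp (ladder_realizable U1) (ladder_realizable U2))).
  by rewrite /= szE; lia.
move=> x; apply/ffunP=> j; rewrite !ffunE /=.
rewrite (@ladder_effect_ext _ ps _ x); last first.
  move=> i; rewrite u1E => ics; rewrite ffunE /= ladder_effect_notin ?addbF.
    by rewrite (_ : i == t = false) ?addbF //; apply: contraNF tcs => /eqP<-.
  by rewrite u2E; apply: contra dis => id; apply/hasP; exists i.
by rewrite -!addbA addbb addbF -[in RHS]u1E all_map.
Qed.

(** The controls are halved into [A] and [B]. Toggling [a] by [A] and then [t] by [a] and [B], twice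
    in a row, restores [a] and leaves on [t] the conjunction over [A] and [B]. Each half supplies
    the borrowed lines for the other. *)
Lemma realizable_and m (S : {set 'I_m}) (t a : 'I_m) :
  t \notin S -> a \notin S -> a != t ->
  realizable (8 * #|S| + 12) (toggle t (fun x => [forall j in S, x j])).
Proof.
move=> tS aS at_.
pose A := take (uphalf #|S|) (enum S); pose B := drop (uphalf #|S|) (enum S).
have AB : A ++ B = enum S by rewrite cat_take_drop.
have szA : size A = uphalf #|S| by rewrite size_takel // -cardE; lia.
have szB : size B = #|S| - uphalf #|S| by rewrite size_drop -cardE.
have nAB i : i \notin S -> (i \notin A) * (i \notin B).
  by rewrite -mem_enum -AB mem_cat negb_or => /andP[].
have [[tA tB] [aA aB]] := (nAB _ tS, nAB _ aS).
have uAB : uniq (A ++ B) by rewrite AB enum_uniq.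
have uBA : uniq (B ++ A) by rewrite uniq_catC.
have R1 : realizable (4 * size A).+1 (toggle a (fun x => all x A)).
  apply: (@realizable_and_dirty _ _ B); last by rewrite szA szB; lia.
  by rewrite /= uAB mem_cat (negbTE aA) (negbTE aB).
have R2 : realizable (4 * size (a :: B)).+1 (toggle t (fun x => all x (a :: B))).
  apply: (@realizable_and_dirty _ _ A); last by rewrite /= szA szB; lia.
  by rewrite /= inE !mem_cat uBA eq_sym (negbTE at_) (negbTE aA) (negbTE aB) (negbTE tA) (negbTE tB).
apply: realizable_mono
  (realizable_ext _ (realizable_comp (realizable_comp R1 R2) (realizable_comp R1 R2))).
  by have -> : size (a :: B) = (size B).+1 by []; rewrite szA szB; lia.
move=> x; apply/ffunP=> j; rewrite [LHS]ffunE /= !all_toggle //.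
rewrite [toggle a _ _ j]ffunE all_toggle // all_toggle // ![toggle _ _ _ a]ffunE /=.
rewrite eqxx (negbTE at_) /= all_toggle // all_toggle // !addbF.
rewrite !ffunE all_toggle // eqxx /=.
have -> : [forall i in S, x i] = all x A && all x B.
  rewrite -all_cat AB; apply/forallP/allP => [h i|h i].
    by rewrite mem_enum => iS; have := h i; rewrite iS.
  by apply/implyP=> iS; apply: h; rewrite mem_enum.
by case: (j == a) (j == t) (x j) (x a) (all x A) (all x B) => [] [] [] [] [] [].
Qed.

(** * Moving points onto a subcube *)

Lemma realizable_flips m (s : seq 'I_m) :
  uniq s -> realizable (size s) (fun x => [ffun j => x j (+) (j \in s)]).
Proof.
elim: s => [_|t s IH /= /andP[ts us]].
  by apply: realizable_ext (realizable_id _ _) => x; apply/ffunP=> j; rewrite ffunE addbF.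
apply: realizable_mono (realizable_ext _ (realizable_comp (realizable_not t) (IH us))).
  by rewrite add1n.
move=> x; apply/ffunP=> j; rewrite !ffunE inE andbT -addbA; congr (_ (+) _).
by case: eqVneq => // ->; rewrite (negbTE ts).
Qed.

(** Conjugation by NOTs on the lines of [S] where [w] is 0 turns the test for the pattern [w] into a
    test for all ones. *)
Lemma realizable_pattern m (S : {set 'I_m}) (w : vec m) (t a : 'I_m) :
  t \notin S -> a \notin S -> a != t ->
  realizable (10 * #|S| + 12) (toggle t (fun x => [forall j in S, x j == w j])).
Proof.
move=> tS aS at_; have RF := realizable_flips (enum_uniq [set j in S | ~~ w j]).
have szs : #|[set j in S | ~~ w j]| <= #|S|.
  by apply/subset_leq_card/subsetP=> j; rewrite inE => /andP[].
apply: realizable_mono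
  (realizable_ext _ (realizable_comp (realizable_comp RF (realizable_and tS aS at_)) RF)).
  rewrite -cardE; move: szs; set c := #|_|; lia.
move=> x; apply/ffunP=> j; rewrite !ffunE -!addbA; congr (_ (+) _).
rewrite addbC -addbA addbb addbF; congr (_ && _).
apply: eq_forallb => i; rewrite ffunE mem_enum inE.
by case: (i \in S) => //=; case: (x i); case: (w i).
Qed.

(** All targets lie in [A] while the conditions read only lines outside [A], so no toggle affects a
    later condition and the effects add up. *)
Lemma realizable_toggles m (I : eqType) (s : seq I) (A : {set 'I_m})
    (tgt : I -> 'I_m) (h : I -> vec m -> bool) N :
  {in s, forall i, tgt i \in A} ->
  (forall i (x y : vec m), {in ~: A, x =1 y} -> h i x = h i y) ->
  {in s, forall i, realizable N (toggle (tgt i) (h i))} ->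
  realizable (N * size s)
    (fun x => [ffun j => x j (+) \big[addb/false]_(i <- s | tgt i == j) h i x]).
Proof.
move=> tA hA; elim: s tA => [|i s IH] tA R.
  apply: realizable_ext (realizable_id _ _) => x.
  by apply/ffunP=> j; rewrite ffunE big_nil addbF.
have iis : i \in i :: s by rewrite inE eqxx.
have sub : {subset s <= i :: s} by move=> l ls; rewrite inE ls orbT.
have {}IH := IH (sub_in1 sub tA) (sub_in1 sub R).
apply: realizable_mono (realizable_ext _ (realizable_comp (R i iis) IH)).
  by rewrite /= mulnS.
move=> x; apply/ffunP=> j; rewrite ![in LHS]ffunE ffunE big_cons -addbA eq_sym.
rewrite (eq_bigr (fun i' => h i' x)); first by case: ifP.
move=> i' _; apply: hA => l; rewrite inE => lA; rewrite toggle_neq //.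
by apply: contraNneq lA => ->; apply: tA.
Qed.

(** A table lookup: the lines of [S] serve as an address, and when they match the pattern of [r] and
    no other, the word [v r] is added to the lines [u i]. One pattern-controlled NOT is spent per
    table entry. *)
Lemma realizable_write m (I R : finType) (S : {set 'I_m}) (w : R -> vec m)
    (u : I -> 'I_m) (v : R -> I -> bool) :
  injective u -> (forall i, u i \notin S) ->
  (forall i, exists2 a, a \notin S & a != u i) ->
  exists2 F : vec m -> vec m, realizable (#|I| * #|R| * (10 * #|S| + 12)) F &
    forall (x : vec m) r, (forall r', [forall l in S, x l == w r' l] = (r' == r)) ->
      (forall i, F x (u i) = x (u i) (+) v r i) /\
      (forall j, (forall i, u i != j) -> F x j = x j).
Proof.
move=> uI uS spare.
pose h (p : I * R) (x : vec m) := v p.2 p.1 && [forall l in S, x l == w p.2 l].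
have Rl := @realizable_toggles m _ (enum {: I * R}) (~: S) (fun p => u p.1) h
  (10 * #|S| + 12).
eexists.
  apply: realizable_mono (Rl _ _ _).
  - by rewrite -cardE card_prod mulnC.
  - by move=> p _; rewrite inE uS.
  - move=> p x y xy; rewrite /h; congr (_ && _); apply: eq_forallb => l.
    by case: (boolP (l \in S)) => //= lS; rewrite xy // !inE negbK.
  - move=> p _; rewrite /h; case: (v p.2 p.1) => /=.
      by have [a aS au] := spare p.1; apply: realizable_pattern aS au.
    apply: realizable_ext (realizable_id _ _) => x.
    by apply/ffunP=> j; rewrite ffunE andbF addbF.
move=> x r hr; split=> [i|j ju]; rewrite ffunE big_enum_cond /=; last first.
  by rewrite big_pred0 ?addbF // => p; rewrite (negbTE (ju _)).
congr (_ (+) _); rewrite (bigD1 (i, r)) ?eqxx //= big1 => [|[i' r'] /=].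
  by rewrite addbF /h /= hr eqxx andbT.
case/andP=> /eqP/uI->; rewrite xpair_eqE eqxx /h /= hr => /negbTE->.
by rewrite andbF.
Qed.

Lemma injection_into (T T' : finType) (A : {set T'}) :
  #|T| <= #|A| -> exists2 f : T -> T', injective f & forall x, f x \in A.
Proof.
move=> le; have lt (x : T) : enum_rank x < #|A| by apply: leq_trans (ltn_ord _) le.
exists (fun x => enum_val (Ordinal (lt x))); last by move=> x; apply: enum_valP.
by move=> x y /enum_val_inj /(congr1 val) /= /val_inj /enum_rank_inj.
Qed.

(** Points of the cube of dimension [k + 1]. The coordinate [None] is singled out as the one to be
    flipped; the other [k] number the transpositions. *)
Notation row k := {ffun option 'I_k -> bool}.

Lemma card_row k : #|{: row k}| = 2 ^ k.+1.
Proof. by rewrite card_ffun card_bool card_option card_ord. Qed.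

(* Lines carrying equal columns are cleared by CNOTs, which leaves at most
   2 ^ 2 ^ k.+1 lines that are nonzero on the given points; the other lines are
   clean, so the index of the point can be written there and then used to clear
   everything else. *)
Lemma realizable_canonical m k (z : row k -> vec m) :
  injective z -> 0 < k -> 2 ^ (3 * 2 ^ k.+1) <= m ->
  exists u : option 'I_k -> 'I_m, exists F, [/\ injective u, realizable (45 * m) F &
    forall r, (forall i, F (z r) (u i) = r i) /\
              (forall j, (forall i, u i != j) -> F (z r) j = false)].
Proof.
move=> zI k0 le.
set K := 2 ^ k.+1 in le; pose B := 2 ^ K.
have KB : K < B by apply: ltn_expl.
have kK : k.+1 < K by apply: ltn_expl.
have K4 : 4 <= K by rewrite /K !expnS; have := expn_gt0 2 k.-1; case: (k) k0 => // k' _; rewrite expnS /=; lia.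
have B16 : 2 ^ 4 <= B by rewrite leq_exp2l.
have B3 : B * B * B <= m by move: le; rewrite mulnC expnM !expnS expn0 -/B; lia.
have m0 : 0 < m by apply: leq_trans B3; rewrite !muln_gt0; lia.
pose col j : {ffun row k -> bool} := [ffun r => z r j].
(* A chosen line with column [c]; the default is taken only for columns that no line has. *)
pose rep c : 'I_m := odflt (Ordinal m0) [pick i | col i == c].
have repE j r : z r (rep (col j)) = z r j.
  have : col (rep (col j)) = col j.
    by rewrite /rep; case: pickP => [i /eqP//|/(_ j)]; rewrite eqxx.
  by move/ffunP/(_ r); rewrite !ffunE.
pose J := [set rep c | c in {: {ffun row k -> bool}}].
have repJ j : rep (col j) \in J by apply: imset_f.
have cJ : #|J| <= B.
  by apply: leq_trans (leq_imset_card _ _) _; rewrite card_ffun card_bool card_row.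
have cCJ : #|J| + #|~: J| = m by rewrite cardsC card_ord.
have [u uI uJ] : exists2 u : option 'I_k -> 'I_m, injective u & forall i, u i \in ~: J.
  by apply: injection_into; rewrite card_option card_ord; nia.
(* Stage 1: each line outside [J] is cleared on the given points by a CNOT from its
   representative. *)
have R1 := @realizable_toggles m _ (enum (~: J)) (~: J) id (fun j x => x (rep (col j))) 1.
have {}R1 : realizable m (fun x => [ffun j => x j (+) \big[addb/false]_(i <- enum (~: J) | i == j) x (rep (col i))]).
  apply: realizable_mono (R1 _ _ _); first by rewrite -cardE mul1n; lia.
  - by move=> j; rewrite mem_enum.
  - by move=> j x y xy; apply: xy; rewrite inE inE negbK.
  - move=> j; rewrite mem_enum inE => jJ; apply: realizable_cnot.
    by apply: contraNneq jJ => <-.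
move: R1; set F1 := (fun x : vec m => _) => R1.
have F1J r j : j \in J -> F1 (z r) j = z r j.
  move=> jJ; rewrite ffunE big_enum_cond big_pred0 ?addbF // => i.
  by case: eqP => [->|]; rewrite ?andbF // inE jJ.
have F1CJ r j : j \notin J -> F1 (z r) j = false.
  move=> jJ; rewrite ffunE big_enum_cond (big_pred1 j) ?repE ?addbb // => i.
  by rewrite in_setC /=; case: eqP => [->|]; rewrite ?jJ ?andbF //.
(* Stage 2: the lines of [J] determine the point, since all columns are repeated there and [z] is
   injective; addressed by them, the index [r] is written on the clean lines [u i]. *)
have [F2 R2 F2E] : exists2 F : vec m -> vec m, realizable (#|{: option 'I_k}| * #|{: row k}| * (10 * #|J| + 12)) F &
    forall (x : vec m) r, (forall r', [forall l in J, x l == z r' l] = (r' == r)) ->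
      (forall i, F x (u i) = x (u i) (+) (r : row k) i) /\
      (forall j, (forall i, u i != j) -> F x j = x j).
  apply: (@realizable_write m _ _ J z u (fun r i => r i)) => // i.
    by have := uJ i; rewrite inE.
  exists (u (if i is None then Some (Ordinal k0) else None)).
    by have := uJ (if i is None then Some (Ordinal k0) else None); rewrite inE.
  by apply/eqP=> /uI; case: (i).
pose U := [set u i | i in {: option 'I_k}].
have cU : #|U| = k.+1 by rewrite card_imset // card_option card_ord.
pose e (r : row k) : vec m := [ffun j => [exists i, (u i == j) && r i]].
have eu r i : e r (u i) = r i.
  rewrite ffunE; apply/existsP/idP => [[i' /andP[/eqP/uI->]]//|ri].
  by exists i; rewrite eqxx.
(* Stage 3: addressed by the index now on [U], the values on [J] are added to themselves and
   vanish. *)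
have [F3 R3 F3E] : exists2 F : vec m -> vec m, realizable (#|{: {j : 'I_m | j \in J}}| * #|{: row k}| * (10 * #|U| + 12)) F &
    forall (x : vec m) r, (forall r', [forall l in U, x l == e r' l] = (r' == r)) ->
      (forall i : {j : 'I_m | j \in J}, F x (val i) = x (val i) (+) z r (val i)) /\
      (forall j, (forall i : {j : 'I_m | j \in J}, val i != j) -> F x j = x j).
  apply: (@realizable_write m _ _ U e _ (fun r i => z r (val i))) => [|i|i].
  - exact: val_inj.
  - apply/imsetP=> [[i' _ ii]]; have := uJ i'; rewrite inE -ii.
    by rewrite (valP i).
  - have : 0 < #|~: (val i |: U)|.
      have := cardsC (val i |: U); rewrite card_ord cardsU1 cU.
      by case: (_ \notin _) => /=; nia.
    case/card_gt0P=> a; rewrite inE in_setU1 negb_or => /andP[ai aU].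
    by exists a.
exists u, (fun x => F3 (F2 (F1 x))); split=> // [|r].
  apply: realizable_mono (realizable_comp (realizable_comp R1 R2) R3).
  rewrite card_option card_ord card_row card_sig cU -/K.
  have -> : #|[pred x in J]| = #|J| by apply: eq_card.
  (* Stages 2 and 3 cost at most [11 * B ^ 3] gates each, and [B ^ 3 <= m]. *)
  have b2 : k.+1 * K * (10 * #|J| + 12) <= B * B * (11 * B) by rewrite !leq_mul //; lia.
  have b3 : #|J| * K * (10 * k.+1 + 12) <= B * B * (11 * B) by rewrite !leq_mul //; lia.
  by nia.
have key r' : [forall l in J, F1 (z r) l == z r' l] = (r' == r).
  apply/forallP/eqP => [h|-> l]; last by apply/implyP=> lJ; rewrite F1J.
  apply: zI; apply/ffunP=> j; rewrite -[LHS]repE -[RHS]repE.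
  by have := h (rep (col j)); rewrite repJ /= F1J // => /eqP.
have [F2u F2n] := F2E _ _ key.
have F2uE i : F2 (F1 (z r)) (u i) = r i.
  by rewrite F2u F1CJ //; have := uJ i; rewrite inE.
have key3 r' : [forall l in U, F2 (F1 (z r)) l == e r' l] = (r' == r).
  apply/forallP/eqP => [h|-> l].
    apply/ffunP=> i; have := h (u i).
    by rewrite imset_f //= F2uE eu => /eqP.
  by apply/implyP=> /imsetP[i _ ->]; rewrite F2uE eu.
have [F3u F3n] := F3E _ _ key3; split=> [i|j ju].
  rewrite F3n ?F2uE // => j; apply: contraTneq (uJ i) => <-.
  by rewrite inE (valP j).
case: (boolP (j \in J)) => jJ.
  rewrite (F3u (exist _ j jJ)) /= F2n // F1J //; first by rewrite addbb.
rewrite F3n ?F2n ?F1CJ // => i; apply: contraNneq jJ => <-.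
exact: valP.
Qed.

(** * Products of disjoint transpositions *)

Definition flip_row k (r : row k) : row k := [ffun i => r i (+) (i == None)].

Lemma flip_rowK k : involutive (@flip_row k).
Proof. by move=> r; apply/ffunP=> i; rewrite !ffunE -addbA addbb addbF. Qed.

(** For injective [z] this is a product of [2 ^ k] disjoint transpositions, one for each pair of
    rows differing at [None]. *)
Definition swap_rows m k (z : row k -> vec m) (v : vec m) : vec m :=
  if [pick r | z r == v] is Some r then z (flip_row r) else v.

Lemma swap_rows_in m k (z : row k -> vec m) r :
  injective z -> swap_rows z (z r) = z (flip_row r).
Proof.
move=> zI; rewrite /swap_rows; case: pickP => [r' /eqP/zI->//|/(_ r)].
by rewrite eqxx.
Qed.

Lemma swap_rows_out m k (z : row k -> vec m) v :
  (forall r, z r != v) -> swap_rows z v = v.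
Proof. by move=> h; rewrite /swap_rows; case: pickP => // r; rewrite (negbTE (h r)). Qed.

Lemma swap_rowsK m k (z : row k -> vec m) :
  injective z -> involutive (swap_rows z).
Proof.
move=> zI v; case: (pickP (fun r => z r == v)) => [r /eqP<-|h].
  by rewrite !swap_rows_in // flip_rowK.
by rewrite !swap_rows_out // => r; rewrite ?swap_rows_out h // => r'; rewrite h.
Qed.

(** Conjugation by the canonical form [C] turns the product into [M], a single NOT on [u None]
    conditioned on zeros on all lines outside [U]. Twice 45 [m] for [C] and its inverse plus about
    10 [m] for [M] give the bound. *)
Lemma realizable_swap_rows m k (z : row k -> vec m) :
  injective z -> 0 < k -> 2 ^ (3 * 2 ^ k.+1) <= m ->
  realizable (100 * m) (swap_rows z).
Proof.
move=> zI k0 le; have [u [C [uI RC CE]]] := realizable_canonical zI k0 le.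
have [D [CD DC RD]] := realizable_inv RC.
pose U := [set u i | i in {: option 'I_k}].
have uU i : u i \in U by rewrite imset_f.
have cU : #|U| = k.+1 by rewrite card_imset // card_option card_ord.
have km : k.+1 < 2 ^ k.+1 by apply: ltn_expl.
have m12 : 2 ^ 12 <= m.
  apply: leq_trans le; rewrite leq_exp2l //; have : 2 ^ 2 <= 2 ^ k.+1 by rewrite leq_exp2l.
  by lia.
have cCU := cardsC U; rewrite cU card_ord in cCU.
(* As [k] is positive, the subcube has a second line; it is not a control of [M] and serves as its
   spare line. *)
have un0 : u (Some (Ordinal k0)) != u None by apply/eqP=> /uI.
have RM := @realizable_pattern m (~: U) [ffun => false] (u None) _ _ _ un0.
rewrite !inE !uU in RM; have {}RM := RM isT isT.
move: RM; set M := toggle _ _ => RM.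
apply: realizable_mono (realizable_ext _ (realizable_comp (realizable_comp RC RM) RD)).
  by clear -cCU k0; move: cCU; set c := #|~: U|; lia.
have canonP (x y : vec m) : (forall i, x (u i) = y (u i)) ->
    (forall j, (forall i, u i != j) -> x j = y j) -> x = y.
  move=> hu hn; apply/ffunP=> j; case: (boolP (j \in U)) => [/imsetP[i _ ->]//|jU].
  by apply: hn => i; apply: contraNneq jU => <-.
move=> v; case: (pickP (fun r => z r == v)) => [r /eqP<-|h].
  rewrite swap_rows_in // -[RHS]CD; congr D.
  have [Cu Cn] := CE r; have [Cu' Cn'] := CE (flip_row r).
  have all0 : [forall j in ~: U, C (z r) j == [ffun => false] j].
    apply/forallP=> j; apply/implyP; rewrite inE => jU; rewrite ffunE Cn //.
    by move=> i; apply: contraNneq jU => <-.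
  apply: canonP => [i|j ju].
    by rewrite Cu' /M !ffunE all0 andbT Cu (inj_eq uI).
  by rewrite Cn' // /M toggle_neq ?Cn // eq_sym ju.
rewrite swap_rows_out => [|r]; last by rewrite h.
suff -> : M (C v) = C v by [].
rewrite /M; set b := fun _ => _; suff bF : b (C v) = false.
  by apply/ffunP=> j; rewrite ffunE bF andbF addbF.
(* If [C v] vanished outside [U], it would be the canonical image of the row read off on [U], and
   [v] would be one of the points [z r]. *)
apply/negP => /forallP all0.
have /eqP := h [ffun i => C v (u i)]; case.
rewrite -[LHS]CD -[RHS]CD; congr D.
have [Cu Cn] := CE [ffun i => C v (u i)].
apply: canonP => [i|j ju]; first by rewrite Cu ffunE.
rewrite Cn //; have := all0 j; rewrite inE ffunE.
have -> /= : j \notin U by apply/imsetP=> [[i _ ji]]; have := ju i; rewrite ji eqxx.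
by move/eqP.
Qed.

Local Open Scope group_scope.

(* A gate with target [t] is the commutator of two involutive gates through a
   spare line [a]: one with the same controls and target [a], and one with
   control [a] and target [t]. *)
Lemma gate_even m (g : gate m) : 3 < m -> valid_gate g ->
  exists2 p : {perm vec m}, p =1 apply_gate g & ~~ odd_perm p.
Proof.
case: g => S t m4 vg; have /andP[/= cS tS] := vg.
have [a] : exists a, a \in ~: (t |: S).
  apply/card_gt0P; have := cardsC (t |: S); rewrite card_ord cardsU1.
  by move: cS; case: (_ \notin _); set s := #|S|; set c' := #|_|; lia.
rewrite !inE negb_or => /andP[at_ aS].
have v1 : valid_gate (S, a) by rewrite /valid_gate /= cS.
have v2 : valid_gate ([set a], t) by rewrite /valid_gate /= cards1 inE eq_sym.
pose p1 := perm (inv_inj (apply_gateK v1)); pose p2 := perm (inv_inj (apply_gateK v2)).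
exists (p1 * p2 * p1 * p2); last by rewrite !odd_permM; case: (odd_perm p1); case: (odd_perm p2).
move=> x; rewrite !permM !permE !apply_gateE /=.
have eS (y : vec m) l b : l \notin S ->
    [forall c in S, toggle l b y c] = [forall c in S, y c].
  move=> lS; apply: eq_forallb => c; case: (boolP (c \in S)) => //= cS'.
  by rewrite toggle_neq //; apply: contraNneq lS => <-.
have e1 (y : vec m) : [forall c in [set a], y c] = y a.
  apply/forallP/idP => [/(_ a)|ya c]; first by rewrite inE eqxx.
  by rewrite inE; apply/implyP=> /eqP->.
apply/ffunP=> j; rewrite [LHS]ffunE e1 [toggle a _ _ a]ffunE eqxx /= !eS //.
rewrite [toggle a _ _ j]ffunE !eS // [toggle t _ _ a]ffunE (negbTE at_) addbF.
rewrite [toggle t _ _ j]ffunE e1 [toggle a _ _ a]ffunE eqxx /= !ffunE.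
set b := [forall c in S, x c].
by case: (j == a) (j == t) (x j) (x a) b => [] [] [] [] [].
Qed.

Lemma circuit_even m (c : circuit m) : 3 < m -> all (@valid_gate m) c ->
  exists2 p : {perm vec m}, p =1 run c & ~~ odd_perm p.
Proof.
move=> m4; elim: c => [_|g c IH /= /andP[vg /IH[p pE pe]]].
  by exists 1; rewrite ?odd_perm1 // => x; rewrite perm1.
have [p' p'E p'e] := gate_even m4 vg.
exists (p' * p); last by rewrite odd_permM (negbTE pe) (negbTE p'e).
by move=> x; rewrite permM p'E pE.
Qed.

Lemma realizable_even m N (p : {perm vec m}) : 3 < m -> realizable N p -> ~~ odd_perm p.
Proof.
move=> m4 [c [vc _ pE]]; have [p' p'E p'e] := circuit_even m4 vc.
by have -> : p = p' by apply/permP=> x; rewrite p'E pE.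
Qed.

Lemma realizable_permM m N1 N2 (p q : {perm vec m}) :
  realizable N1 p -> realizable N2 q -> realizable (N1 + N2) (p * q).
Proof.
move=> Rp Rq; apply: realizable_ext (realizable_comp Rp Rq) => x.
by rewrite permM.
Qed.

Lemma realizable_permV m N (p : {perm vec m}) : realizable N p -> realizable N p^-1.
Proof.
case/realizable_inv => G [pG Gp R]; apply: realizable_ext R => x.
by apply: (@perm_inj _ p); rewrite Gp permKV.
Qed.

(** The case [k = 1] of the products above, for which the number of lines required is
    [2 ^ (3 * 2 ^ 2)]. *)
Lemma realizable_tperm_disjoint m (a b c d : vec m) :
  2 ^ 12 <= m -> uniq [:: a; b; c; d] ->
  realizable (100 * m) (tperm a b * tperm c d).
Proof.
rewrite /= !inE !negb_or => m12 /and4P[/and3P[ab ac ad] /andP[bc bd] cd _].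
pose o : 'I_1 := ord0.
pose z (r : row 1) := if r (Some o) then if r None then d else c else
                      if r None then b else a.
have rowP (r r' : row 1) : r (Some o) = r' (Some o) -> r None = r' None -> r = r'.
  by move=> h1 h2; apply/ffunP=> [[i|]] //; rewrite (ord1 i).
have zI : injective z.
  move=> r r'; move=> /eqP zz; apply: rowP; move: zz; rewrite /z;
  do 4!case: ifP => _; rewrite ?[b == a]eq_sym ?[c == a]eq_sym ?[c == b]eq_sym
    ?[d == a]eq_sym ?[d == b]eq_sym ?[d == c]eq_sym;
  by rewrite ?(negbTE ab) ?(negbTE ac) ?(negbTE ad) ?(negbTE bc) ?(negbTE bd) ?(negbTE cd).
apply: realizable_ext (realizable_swap_rows zI _ _) => // v.
pose mk s f : row 1 := [ffun i => if i is None then f else s].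
have zmk s f : z (mk s f) = if s then if f then d else c else if f then b else a.
  by rewrite /z !ffunE.
have fmk s f : flip_row (mk s f) = mk s (~~ f).
  by apply: rowP; rewrite !ffunE /= ?addbF ?addbT.
have sw s f := swap_rows_in (mk s f) zI; rewrite permM.
case: (eqVneq v a) => [->|va].
  have := sw false false; rewrite fmk !zmk /= => ->.
  by rewrite tpermL tpermD // eq_sym.
case: (eqVneq v b) => [->|vb].
  have := sw false true; rewrite fmk !zmk /= => ->.
  by rewrite tpermR tpermD // eq_sym.
rewrite (@tpermD _ a b) 1?eq_sym //.
case: (eqVneq v c) => [->|vc].
  by have := sw true false; rewrite fmk !zmk /= => ->; rewrite tpermL.
case: (eqVneq v d) => [->|vd].
  by have := sw true true; rewrite fmk !zmk /= => ->; rewrite tpermR.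
rewrite tpermD 1?eq_sym // swap_rows_out // => r; rewrite /z eq_sym.
by do 2!case: ifP.
Qed.

Lemma card_vec m : #|{: vec m}| = (2 ^ m)%N.
Proof. by rewrite card_ffun card_bool card_ord. Qed.

(** Overlapping transpositions are separated by inserting a transposition of two fresh points twice,
    which gives two disjoint pairs. *)
Lemma realizable_tperm_pair m (a b c d : vec m) :
  2 ^ 12 <= m -> a != b -> c != d ->
  realizable (200 * m) (tperm a b * tperm c d).
Proof.
move=> m12 ab cd.
have big : 6 <= #|~: [set:: [:: a; b; c; d]]|.
  have := cardsC [set:: [:: a; b; c; d]]; rewrite card_vec => cC.
  have : #|[set:: [:: a; b; c; d]]| <= 4.
    by rewrite cardsE; apply: leq_trans (card_size _) _.
  have : m < 2 ^ m by apply: ltn_expl.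
  by lia.
have [e] : exists e, e \in ~: [set:: [:: a; b; c; d]] by apply/card_gt0P; lia.
rewrite !inE !negb_or => /and4P[ea eb ec ed].
have [f] : exists f, f \in ~: [set:: [:: a; b; c; d]] :\ e.
  by apply/card_gt0P; have := cardsD1 e (~: [set:: [:: a; b; c; d]]); case: (e \in _); lia.
rewrite !inE !negb_or => /andP[fe /and4P[fa fb fc fd]].
have -> : tperm a b * tperm c d = (tperm a b * tperm e f) * (tperm e f * tperm c d).
  by rewrite mulgA -[_ * tperm e f * tperm e f]mulgA tperm2 mulg1.
apply: realizable_mono (realizable_permM (realizable_tperm_disjoint _ _)
  (realizable_tperm_disjoint _ _)) => //; first by lia.
- by rewrite /= !inE !negb_or ab ![a == _]eq_sym ![b == _]eq_sym ea eb fa fb [e == f]eq_sym fe.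
- by rewrite /= !inE !negb_or cd ec ed fc fd [e == f]eq_sym fe.
Qed.

(** * Even permutations *)

Definition supp (T : finType) (p : {perm T}) : {set T} := [set x | p x != x].

Lemma supp_eq0 (T : finType) (p : {perm T}) : #|supp p| = 0 -> p = 1.
Proof.
move=> /eqP; rewrite cards_eq0 => /eqP/setP p0; apply/permP=> x.
by have := p0 x; rewrite perm1 !inE => /negbFE/eqP.
Qed.

(** Greedy choice: each chosen point excludes at most itself, its image and its preimage. *)
Lemma independent_moved_points (T : finType) (p : {perm T}) n :
  3 * n <= #|supp p| ->
  exists X : {set T}, [/\ #|X| = n, X \subset supp p & {in X, forall x, p x \notin X}].
Proof.
elim: n => [_|n IH le].
  by exists set0; rewrite cards0 sub0set; split=> // x; rewrite inE.
have [|X [cX Xs Xp]] := IH; first by move: le; set c := #|_|; lia.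
have [x] : exists x, x \in supp p :\: (X :|: (p @: X :|: p @^-1: X)).
  apply/set0Pn; apply: contraTneq le => /eqP; rewrite setD_eq0 => /subset_leq_card le.
  rewrite -ltnNge; apply: leq_ltn_trans le _.
  have c1 : #|p @: X| = n by rewrite card_imset //; apply: perm_inj.
  have c2 : #|p @^-1: X| = n.
    by rewrite on_card_preimset ?cX //; apply: onW_bij; apply: injF_bij; apply: perm_inj.
  rewrite !cardsU cX c1 c2; lia.
rewrite !inE !negb_or => /andP[/and3P[xX xpX pxX] px].
exists (x |: X); split.
- by rewrite cardsU1 xX cX.
- by rewrite subUset sub1set inE px.
- move=> y; rewrite !inE => /orP[/eqP->|yX]; first by rewrite negb_or px.
  by rewrite negb_or Xp // andbT; apply: contraNneq xpX => <-; apply: imset_f.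
Qed.

(** [s] exchanges [x] and [p x] for [2 ^ k] independent moved points [x]. Since [s] acts first in
    [s * p], every such [p x] becomes fixed, and points fixed by [p] stay fixed. *)
Lemma swap_rows_reduce m k (p : {perm vec m}) :
  0 < k -> 2 ^ (3 * 2 ^ k.+1) <= m -> 3 * 2 ^ k <= #|supp p| ->
  exists2 s : {perm vec m}, realizable (100 * m) s &
    #|supp (s * p)| + 2 ^ k <= #|supp p|.
Proof.
move=> k0 le /independent_moved_points[X [cX /subsetP Xs Xp]].
have [f fI fX] : exists2 f : {ffun 'I_k -> bool} -> vec m, injective f & forall t, f t \in X.
  by apply: injection_into; rewrite cX card_ffun card_bool card_ord.
pose tl (r : row k) : {ffun 'I_k -> bool} := [ffun i => r (Some i)].
pose z (r : row k) := if r None then p (f (tl r)) else f (tl r).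
have rowP (r r' : row k) : tl r = tl r' -> r None = r' None -> r = r'.
  move=> /ffunP h1 h2; apply/ffunP=> [[i|]] //.
  by have := h1 i; rewrite !ffunE.
have zI : injective z.
  move=> r r'; rewrite /z; case: ifP => rN; case: ifP => rN'.
  - by move/perm_inj/fI/rowP; apply; rewrite rN rN'.
  - by move=> e; have := Xp _ (fX (tl r)); rewrite e fX.
  - by move=> e; have := Xp _ (fX (tl r')); rewrite -e fX.
  - by move/fI/rowP; apply; rewrite rN rN'.
have zs r : z r \in supp p.
  have h := Xs _ (fX (tl r)); rewrite /z; case: ifP => // _.
  by move: h; rewrite !inE (inj_eq perm_inj).
exists (perm (inv_inj (swap_rowsK zI))).
  by apply: realizable_ext (realizable_swap_rows zI k0 le) => v; rewrite permE.
pose Y := [set p (f t) | t in {: {ffun 'I_k -> bool}}].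
have cY : #|Y| = (2 ^ k)%N.
  by rewrite card_imset ?card_ffun ?card_bool ?card_ord //; apply: inj_comp perm_inj fI.
have Ys : Y \subset supp p.
  apply/subsetP=> _ /imsetP[t _ ->]; have := Xs _ (fX t).
  by rewrite !inE (inj_eq perm_inj).
have sub : supp (perm (inv_inj (swap_rowsK zI)) * p) \subset supp p :\: Y.
  apply/subsetP=> v; rewrite inE permM permE => mv; rewrite in_setD; apply/andP; split.
    apply: contra mv => /imsetP[t _ ->].
    pose r : row k := [ffun i => if i is Some j then t j else true].
    have tr : tl r = t by apply/ffunP=> i; rewrite !ffunE.
    have tfr : tl (flip_row r) = t by apply/ffunP=> i; rewrite !ffunE addbF.
    have -> : p (f t) = z r by rewrite /z ffunE tr.
    by rewrite swap_rows_in // /z !ffunE /= tr tfr.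
  rewrite inE; apply: contra mv => /eqP pv.
  rewrite swap_rows_out ?pv // => r; apply: contraTneq (zs r) => ->.
  by rewrite inE pv eqxx.
move/subset_leq_card: sub; rewrite cardsDS // cY.
have := subset_leq_card Ys; rewrite cY; set a := (2 ^ k)%N; set b := #|supp p|; set c := #|_|; lia.
Qed.

Lemma supp_tperm_mul (T : finType) (p : {perm T}) x :
  p x != x -> #|supp (tperm x (p x) * p)| < #|supp p|.
Proof.
move=> px; apply/proper_card/properP; split; last first.
  by exists (p x); rewrite !inE ?(inj_eq perm_inj) // permM tpermR eqxx.
apply/subsetP=> v; rewrite !inE permM; apply: contra => /eqP pv.
rewrite tpermD ?pv //; first by apply: contraNneq px => ->; rewrite pv.
by apply: contraNneq px => e; apply/eqP/(@perm_inj _ p); rewrite e pv.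
Qed.

(** Two transpositions are split off at a time, each fixing at least one more point. After the first
    the rest is odd, hence not the identity, so a second one is always available. *)
Lemma realizable_even_perm m s (p : {perm vec m}) :
  2 ^ 12 <= m -> ~~ odd_perm p -> #|supp p| <= s ->
  realizable (s * (200 * m)) p.
Proof.
move=> m12; elim/ltn_ind: s p => s IH p pe ps.
case: (eqVneq #|supp p| 0) => [/supp_eq0->|].
  by apply: realizable_ext (realizable_id _ _) => x; rewrite perm1.
rewrite -lt0n => /card_gt0P[x]; rewrite inE => px.
have c1 := supp_tperm_mul px; set p1 := (_ * p) in c1.
have o1 : odd_perm p1 by rewrite odd_permM odd_tperm eq_sym px (negbTE pe).
have [y] : exists y, y \in supp p1.
  apply/card_gt0P; rewrite lt0n; apply: contraTneq o1 => /supp_eq0->.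
  by rewrite odd_perm1.
rewrite inE => py; have c2 := supp_tperm_mul py; set p2 := (_ * p1) in c2.
have e2 : ~~ odd_perm p2 by rewrite odd_permM odd_tperm eq_sym py o1.
have -> : p = (tperm x (p x) * tperm y (p1 y)) * p2.
  by rewrite -mulgA [tperm y _ * _]mulgA tperm2 mul1g /p1 mulgA tperm2 mul1g.
have s2 : 1 < s by move: ps c1 c2; set a := #|_|; set b := #|_|; set c := #|_|; lia.
have lt : s.-2 < s by lia.
have le2 : #|supp p2| <= s.-2.
  by move: ps c1 c2; set a := #|_|; set b := #|_|; set c := #|_|; lia.
apply: realizable_mono (realizable_permM (realizable_tperm_pair m12 _ _) (IH _ lt _ e2 le2)).
- by rewrite -mulSn leq_mul2r; apply/orP; right; lia.
- by rewrite eq_sym.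
- by rewrite eq_sym.
Qed.

(** At most [j] rounds each fix [2 ^ k] more points for [100 * m] gates; the fewer than [3 * 2 ^ k]
    or so points left are charged [200 * m] each, whence [6 * 2 ^ k]. *)
Lemma realizable_even_perm_grouped m k j (p : {perm vec m}) :
  0 < k -> 2 ^ (3 * 2 ^ k.+1) <= m -> ~~ odd_perm p ->
  #|supp p| <= 3 * 2 ^ k + j * 2 ^ k ->
  realizable (100 * m * (j + 6 * 2 ^ k)) p.
Proof.
move=> k0 le.
have m12 : 2 ^ 12 <= m.
  apply: leq_trans le; rewrite leq_exp2l //.
  have : 2 ^ 2 <= 2 ^ k.+1 by rewrite leq_exp2l.
  by rewrite -[(2 ^ 2)%N]/4; set K := (2 ^ k.+1)%N; lia.
have m4 : 3 < m by apply: leq_trans m12; rewrite -[4]/(2 ^ 2)%N leq_exp2l.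
elim: j p => [|j IH] p pe ps.
  apply: realizable_mono (realizable_even_perm m12 pe ps).
  by set K := (2 ^ k)%N; nia.
case: (leqP (3 * 2 ^ k) #|supp p|) => [big|small]; last first.
  apply: realizable_mono (realizable_even_perm m12 pe (ltnW small)).
  by set K := (2 ^ k)%N; nia.
have [s Rs cs] := swap_rows_reduce k0 le big.
(* Evenness of [s] keeps the remaining factor even. *)
have se := realizable_even m4 Rs.
have -> : p = s^-1 * (s * p) by rewrite mulKg.
apply: realizable_mono (realizable_permM (realizable_permV Rs) (IH _ _ _)).
- by set K := (2 ^ k)%N; nia.
- by rewrite odd_permM (negbTE se) (negbTE pe).
- by move: ps cs; rewrite mulSn; set K := (2 ^ k)%N; set a := #|_|; set b := #|_|; lia.
Qed.

(** * Extending partial injections to even permutations of small support *)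

Lemma perm_extension (T U : finType) (g h : T -> U) :
  injective g -> injective h ->
  exists2 p : {perm U}, perm_on (g @: setT :|: h @: setT) p & forall x, p (g x) = h x.
Proof.
move=> gI hI; set A := _ :|: _.
have gA x : g x \in A by rewrite inE imset_f.
have hA x : h x \in A by rewrite inE imset_f ?orbT.
suff [p pA ph] : exists2 p : {perm U}, perm_on A p & {in enum T, forall x, p (g x) = h x}.
  by exists p => // x; apply: ph; rewrite mem_enum.
elim: (enum T) (enum_uniq T) => [_|x s IH /= /andP[xs us]]; first by exists 1; rewrite ?perm_on1.
(* The transposition corrects the value at [g x]; an earlier value [h y = p (g y)] differs from both
   [p (g x)] and [h x] and survives. *)
have [p pA ph] := IH us; exists (p * tperm (p (g x)) (h x)) => [|y].
  apply: perm_onM => //; apply: subset_trans (tperm_on _ _) _.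
  by rewrite subUset !sub1set hA perm_closed // gA.
rewrite inE permM => /orP[/eqP->|ys]; first by rewrite tpermL.
have yx : x != y by apply: contraNneq xs => ->.
by rewrite (ph y) // tpermD // ?(inj_eq hI) // -(ph y) // (inj_eq perm_inj) (inj_eq gI).
Qed.

Lemma phi_inj n q : injective (@phi n q).
Proof.
move=> x y /ffunP xy; apply/ffunP=> j; have := xy (lshift q j).
by rewrite !ffunE (unsplitK (inl j)).
Qed.

(** An odd extension is repaired by a transposition of two points outside the image of [phi], which
    accounts for the summand 2; they exist because [q] is positive. *)
Lemma even_perm_extension n q (h : vec n -> vec (n + q)) :
  0 < n -> 0 < q -> injective h ->
  exists p : {perm vec (n + q)},
    [/\ ~~ odd_perm p, #|supp p| <= 2 ^ n.+1 + 2 & forall x, p (phi q x) = h x].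
Proof.
move=> n0 q0 hI; have [p pA ph] := perm_extension (@phi_inj n q) hI.
have cg : #|@phi n q @: setT| = (2 ^ n)%N.
  by rewrite card_imset ?cardsT ?card_vec //; apply: phi_inj.
have ch : #|h @: setT| = (2 ^ n)%N by rewrite card_imset ?cardsT ?card_vec.
have cp : #|supp p| <= 2 ^ n.+1.
  have sub : supp p \subset phi q @: setT :|: h @: setT.
    by apply/subsetP=> v; rewrite inE; apply: (subsetP pA).
  apply: leq_trans (subset_leq_card sub) _.
  by rewrite cardsU cg ch expnS; lia.
case: (boolP (odd_perm p)) => op; last by exists p; split=> //; apply: leq_trans cp (leq_addr _ _).
have : 1 < #|~: (@phi n q @: setT)|.
  have := cardsC (@phi n q @: setT); rewrite cg card_vec.
  have : (2 ^ n.+1 <= 2 ^ (n + q))%N by rewrite leq_exp2l // -addn1 leq_add2l.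
  have : (2 ^ 1 <= 2 ^ n)%N by rewrite leq_exp2l.
  by rewrite expn1 [(2 ^ n.+1)%N]expnS; set a := (2 ^ n)%N; set b := (2 ^ (n + q))%N; set c := #|_|; lia.
case/card_gt1P=> d [e [dg eg de]]; exists (tperm d e * p); split.
- by rewrite odd_permM odd_tperm de op.
- have sub : supp (tperm d e * p) \subset [set d; e] :|: supp p.
    apply/subsetP=> v; rewrite !inE permM; case: (eqVneq v d) => //= vd.
    by case: (eqVneq v e) => //= ve; rewrite tpermD 1?eq_sym.
  apply: leq_trans (subset_leq_card sub) _; rewrite cardsU cards2 de.
  by move: cp; set a := #|_|; set b := #|_|; lia.
- move=> x; rewrite permM tpermD ?ph //.
    by move: dg; rewrite inE; apply: contraNneq => ->; apply: imset_f.
  by move: eg; rewrite inE; apply: contraNneq => ->; apply: imset_f.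
Qed.

Lemma in_F_even_perm n q (f : vec n -> vec n) :
  3 < n -> in_F q f ->
  exists p : {perm vec (n + minn q n)},
    [/\ ~~ odd_perm p, #|supp p| <= 2 ^ n.+1 + 2 & forall x, psi (p (phi _ x)) = f x].
Proof.
move=> n4 [c [vc cf]]; have n0 : 0 < n by lia.
case: (leqP q n) => [qn|nq].
  have [p pE pe] := circuit_even (leq_trans n4 (leq_addr q n)) vc.
  case: (posnP q) => [q0|q0].
    exists p; split=> // [|x]; last by rewrite pE.
    apply: leq_trans (max_card _) _; rewrite card_vec q0 addn0 expnS.
    by set a := (2 ^ n)%N; lia.
  (* The circuit may move nearly [2 ^ (n + q)] points, so only its action on the inputs is kept and
     extended afresh. *)
  have hI : injective (fun x => p (@phi n q x)) by apply: inj_comp perm_inj (@phi_inj n q).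
  have [p' [p'e p's p'h]] := even_perm_extension n0 q0 hI.
  by exists p'; split=> // x; rewrite p'h pE.
(* With [n] additional inputs, keeping a copy of [x] beside [f x] makes the map injective. *)
pose h (x : vec n) : vec (n + n) := [ffun i => match split i with inl j => f x j | inr j => x j end].
have hI : injective h.
  move=> x y /ffunP xy; apply/ffunP=> j; have := xy (rshift n j).
  by rewrite !ffunE (unsplitK (inr j)).
have [p [pe ps ph]] := even_perm_extension n0 n0 hI; exists p; split=> // x.
by rewrite ph; apply/ffunP=> j; rewrite !ffunE (unsplitK (inl j)).
Qed.

(** * Counting and bounds for the Shannon function *)

Local Close Scope group_scope.

(** * Relabelling the lines of a circuit *)

Definition map_gate m m' (u : 'I_m -> 'I_m') (g : gate m) : gate m' :=
  (u @: g.1, u g.2).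

Lemma valid_map_gate m m' (u : 'I_m -> 'I_m') (g : gate m) :
  injective u -> valid_gate g -> valid_gate (map_gate u g).
Proof. by move=> uI; rewrite /valid_gate /= card_imset // mem_imset. Qed.

Lemma run_map_gate m m' (u : 'I_m -> 'I_m') (c : circuit m) (x : vec m) (y : vec m') :
  injective u -> (forall j, y (u j) = x j) ->
  forall j, run (map (map_gate u) c) y (u j) = run c x j.
Proof.
move=> uI; elim: c x y => //= g c IH x y yx; apply: IH => j.
rewrite !apply_gateE !ffunE (inj_eq uI) yx; congr (_ (+) (_ && _)).
apply/forallP/forallP => /= h l.
  by apply/implyP=> lS; have := h (u l); rewrite imset_f //= yx.
by apply/implyP=> /imsetP[i iS ->]; have := h i; rewrite iS /= yx.
Qed.

Lemma implements_widen n q q' (c : circuit (n + q')) (f : vec n -> vec n) :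
  q' <= q -> implements c f -> exists2 c' : circuit (n + q), implements c' f & size c' = size c.
Proof.
move=> le [vc cf]; have le' : n + q' <= n + q by rewrite leq_add2l.
pose u := widen_ord le'; have uI : injective u by move=> i j /(congr1 val) /= /val_inj.
exists (map (map_gate u) c); last by rewrite size_map.
split=> [|x].
  by rewrite all_map; apply: sub_all vc => g; apply: valid_map_gate.
apply/ffunP=> j; rewrite -cf !ffunE.
have -> : lshift q j = u (lshift q' j) by apply: val_inj.
apply: run_map_gate => // i; rewrite !ffunE.
case: (split_ordP i) => k ->.
  have -> : u (lshift q' k) = lshift q k by apply: val_inj.
  by rewrite !(unsplitK (inl k)).
have -> : u (rshift n k) = rshift n (widen_ord le k) by apply: val_inj.
by rewrite (unsplitK (inr (widen_ord le k))).
Qed.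

(** * The Shannon function and its upper bound *)

Lemma has_circuit_of_sizeP n q (f : vec n -> vec n) k :
  reflect (exists c : circuit (n + q), implements c f /\ size c = k)
    (has_circuit_of_size q f k).
Proof. by rewrite /has_circuit_of_size; case: excluded_middle_informative => h; constructor. Qed.

Lemma in_FbP n q (f : {ffun vec n -> vec n}) : reflect (in_F q f) (in_Fb q f).
Proof. by rewrite /in_Fb; case: excluded_middle_informative => h; constructor. Qed.

Lemma min_complexity_le n q (f : {ffun vec n -> vec n}) (c : circuit (n + q)) :
  implements c f -> min_complexity q f <= size c.
Proof.
move=> cf; rewrite /min_complexity; case: excluded_middle_informative => // h.
by case: ex_minnP => k _; apply; apply/has_circuit_of_sizeP; exists c.
Qed.

Lemma L_circuit n q (f : {ffun vec n -> vec n}) :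
  in_F q f -> exists2 c : circuit (n + q), implements c f & size c <= L n q.
Proof.
move=> fF; have fFb : in_Fb q f by apply/in_FbP.
have := @leq_bigmax_cond _ (@in_Fb n q) (@min_complexity n q) f fFb.
rewrite -/(L n q) /min_complexity; case: excluded_middle_informative => [h|[]].
  by case: ex_minnP => k /has_circuit_of_sizeP[c [cf <-]] _ ?; exists c.
by case: fF => c cf; exists (size c); apply/has_circuit_of_sizeP; exists c.
Qed.

Lemma L_upper n q k : 0 < k -> 2 ^ (3 * 2 ^ k.+1) <= n ->
  L n q <= 200 * n * ((2 ^ n.+1 + 2) %/ 2 ^ k + 1 + 6 * 2 ^ k).
Proof.
move=> k0 le; apply/bigmax_leqP => f /in_FbP fF.
have n4 : 3 < n.
  apply: leq_trans le; rewrite -[4]/(2 ^ 2) leq_exp2l //.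
  by have := expn_gt0 2 k.+1; rewrite /=; set a := 2 ^ k.+1; lia.
have [p [pe ps pf]] := in_F_even_perm n4 fF.
(* Enough rounds of [2 ^ k] points to exhaust the whole support. *)
set j := _ %/ _ + 1.
have sz : #|supp p| <= 3 * 2 ^ k + j * 2 ^ k.
  apply: leq_trans ps _; apply: leq_trans (leq_addl _ _).
  by rewrite /j addn1; apply: ltnW; apply: ltn_ceil; rewrite expn_gt0.
have le' : 2 ^ (3 * 2 ^ k.+1) <= n + minn q n by apply: leq_trans le (leq_addr _ _).
have [c [vc sc cp]] := realizable_even_perm_grouped k0 le' pe sz.
have [c' c'f szc] : exists2 c' : circuit (n + q), implements c' f & size c' = size c.
  apply: (implements_widen (geq_minl q n)); split=> // x.
  by rewrite cp pf.
apply: leq_trans (min_complexity_le c'f) _; rewrite szc; apply: leq_trans sc _.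
by rewrite leq_mul2r; apply/orP; right; have := geq_minr q n; lia.
Qed.

(** [k] is taken maximal, [k = 1] being admissible; failure at [k + 1] gives the exponent
    [3 * 2 ^ (k + 2) = 12 * 2 ^ k]. Thus [2 ^ k] has order [log n]. *)
Lemma exists_block_size n : 2 ^ 12 <= n ->
  exists k, [/\ 0 < k, 2 ^ (3 * 2 ^ k.+1) <= n & n < 2 ^ (12 * 2 ^ k)].
Proof.
move=> n12; pose P k := 2 ^ (3 * 2 ^ k.+1) <= n.
have Pb k : P k -> k <= n.
  have : k.+1 < 2 ^ k.+1 by apply: ltn_expl.
  have : 3 * 2 ^ k.+1 < 2 ^ (3 * 2 ^ k.+1) by apply: ltn_expl.
  by rewrite /P; set a := 2 ^ k.+1; set b := 2 ^ _; lia.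
case: (@ex_maxnP P n (ex_intro _ 1 n12) Pb) => k Pk kmax; exists k; split=> //.
  exact: kmax.
rewrite ltnNge; apply/negP => h; have := kmax k.+1.
rewrite /P !expnS ltnn (_ : 3 * _ = 12 * 2 ^ k); last by set a := 2 ^ k; lia.
by move=> /(_ h).
Qed.

(** [M = 12 * 2 ^ k] stands in for the logarithm of [n], so the bound is stated without division. *)
Lemma L_upper_nat n q : 2 ^ 12 <= n ->
  exists2 M, n <= 2 ^ M & L n q * M <= 24 * 1000 * n * 2 ^ n.
Proof.
move=> n12; have [k [k0 le lt]] := exists_block_size n12.
exists (12 * 2 ^ k); first exact: ltnW.
have := L_upper q k0 le; rewrite expnS.
have Kpos : 0 < 2 ^ k by rewrite expn_gt0.
have KK : 2 ^ k * 2 ^ k <= 2 ^ n.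
  apply: leq_trans (leq_mul (ltnW (ltn_expl _ (ltnSn 1))) (ltnW (ltn_expl _ (ltnSn 1)))) _.
  rewrite -expnD leq_exp2l //; apply: leq_trans le.
  apply: leq_trans (ltnW (ltn_expl _ (ltnSn 1))).
  by rewrite expnS; set K := 2 ^ k; lia.
have P2 : 2 <= 2 ^ n.
  by rewrite -[2]/(2 ^ 1) leq_exp2l //; apply: leq_trans n12; rewrite expn_gt0.
have := leq_divM (2 * 2 ^ n + 2) (2 ^ k).
move: (L n q) KK Kpos P2; clear.
set K := 2 ^ k; set P := 2 ^ n; set d := _ %/ _ => l KK Kpos P2 dK.
move=> lle; apply: leq_trans (leq_mul lle (leqnn _)) _.
rewrite (_ : 200 * n * (d + 1 + 6 * K) * (12 * K) = 2400 * n * (d * K + K + 6 * (K * K))); last by nia.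
(* The bracket is at most [(2 * P + 2) + P + 6 * P], hence at most [10 * P]. *)
rewrite (_ : 24 * 1000 * n * P = 2400 * n * (10 * P)); last by nia.
by rewrite leq_mul2l; apply/orP; right; nia.
Qed.

(** * Lower bound by counting circuits *)

Lemma even_perm_in_F n q (s : {perm vec n}) : 2 ^ 12 <= n -> ~~ odd_perm s -> in_F q s.
Proof.
move=> n12 se; have [c [vc _ cs]] := realizable_even_perm n12 se (leqnn _).
exists (map (map_gate (lshift q)) c); split.
  by rewrite all_map; apply: sub_all vc => g; apply: valid_map_gate; apply: lshift_inj.
move=> x; apply/ffunP=> j; rewrite ffunE -cs.
by apply: run_map_gate => [|i]; [apply: lshift_inj | rewrite ffunE (unsplitK (inl i))].
Qed.

(** Up to two controls and a target. A missing target encodes no gate, so codes of shorter circuits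
    can be padded to a fixed length. *)
Definition gate_code m := (option 'I_m * option 'I_m * option 'I_m)%type.

Definition decode_gate m (d : gate_code m) : option (gate m) :=
  omap (fun t => ([set i | (d.1.1 == Some i) || (d.1.2 == Some i)], t)) d.2.

Lemma decode_gate_surj m (g : gate m) : valid_gate g -> exists d, decode_gate d = Some g.
Proof.
case: g => S t /andP[/= cS _]; move: cS; rewrite cardE => cS.
exists (ohead (enum S), ohead (behead (enum S)), Some t); congr (Some (_, _)).
apply/setP=> i; rewrite inE /= -(mem_enum S).
move: cS; case: (enum S) => [|a [|b []]] //= _; rewrite !inE //.
  by rewrite orbF; apply/eqP/eqP => [[]|->].
by congr (_ || _); apply/eqP/eqP => [[]|->].
Qed.

Lemma decode_circuit_surj m (c : circuit m) l :
  all (@valid_gate m) c -> size c <= l ->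
  exists d : l.-tuple (gate_code m), pmap (@decode_gate m) d = c.
Proof.
move=> vc szc.
have [d dc szd] : exists2 d, pmap (@decode_gate m) d = c & size d = size c.
  elim: c vc {szc} => [|g c IH /= /andP[/decode_gate_surj[e eg] /IH[d dc szd]]]; first by exists [::].
  by exists (e :: d); rewrite /= ?eg ?dc ?szd.
have sz : size (d ++ nseq (l - size c) (None, None, None)) == l.
  by rewrite size_cat size_nseq szd subnKC.
exists (Tuple sz) => /=; rewrite pmap_cat dc.
by rewrite (_ : pmap _ (nseq _ _) = [::]) ?cats0 //; elim: (_ - _).
Qed.

Lemma expn_leq_fact N : N ^ N <= (N + N)`!.
Proof.
have h j : N ^ j <= (N + j)`!.
  elim: j => [|j IH]; first by rewrite fact_gt0.
  by rewrite addnS factS expnS leq_mul //; lia.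
exact: h.
Qed.

(** Every even permutation is decoded from some tuple of [L n q] gate codes. There are half of
    [(2 ^ n)!] of them, hence the factor 2, and the upper half of the factors of the factorial is
    bounded below by [2 ^ n.-1]. *)
Lemma L_lower_nat n q : 2 ^ 12 <= n ->
  2 ^ (n.-1 * 2 ^ n.-1) <= 2 * (n + q).+1 ^ (3 * L n q).
Proof.
move=> n12; have n0 : 0 < n by apply: leq_trans n12; rewrite expn_gt0.
have h2 : 2 ^ n.-1 + 2 ^ n.-1 = 2 ^ n.
  by rewrite addnn -mul2n -expnS prednK.
have := expn_leq_fact (2 ^ n.-1); rewrite -expnM h2 => /leq_trans; apply.
rewrite -(card_vec n) -card_Alt; last first.
  by rewrite card_vec -[1]/(2 ^ 0) ltn_exp2l.
rewrite leq_mul2l /=.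
pose D (d : (L n q).-tuple (gate_code (n + q))) : {ffun vec n -> vec n} :=
  [ffun x => psi (run (pmap (@decode_gate _) d) (phi q x))].
have -> : (n + q).+1 ^ (3 * L n q) = #|{: (L n q).-tuple (gate_code (n + q))}|.
  rewrite card_tuple !card_prod !card_option card_ord expnM; congr (_ ^ _).
  by rewrite !expnS expn0 muln1 mulnA.
apply: leq_trans (leq_imset_card D _).
pose G (s : {perm vec n}) : {ffun vec n -> vec n} := [ffun x => s x].
have GI : injective G.
  by move=> s t /ffunP st; apply/permP=> x; have := st x; rewrite !ffunE.
rewrite -(card_imset _ GI); apply/subset_leq_card/subsetP=> _ /imsetP[s sA ->].
have sF : in_F q (G s).
  have se : ~~ odd_perm s by rewrite -Alt_even.
  have [c [vc cs]] := even_perm_in_F q n12 se.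
  by exists c; split=> // x; rewrite cs ffunE.
have [c [vc cs] szc] := L_circuit sF; have [d dc] := decode_circuit_surj vc szc.
by apply/imsetP; exists d => //; apply/ffunP=> x; rewrite !ffunE dc cs ffunE.
Qed.

(** * Asymptotic form with real logarithms *)

Local Open Scope R_scope.

Lemma INR_muln m n : INR (m * n)%N = INR m * INR n.
Proof. exact: mult_INR. Qed.

Lemma INR_expn m n : INR (m ^ n)%N = INR m ^ n.
Proof. by elim: n => [|n IH]; rewrite ?expn0 // expnS INR_muln IH. Qed.

Lemma INR_leq m n : (m <= n)%N -> INR m <= INR n.
Proof. by move/leP/le_INR. Qed.

Lemma ln2_gt0 : 0 < ln 2.
Proof. by have := ln_lt_2; lra. Qed.

Lemma log2R_le x y : 0 < x -> x <= y -> log2R x <= log2R y.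
Proof.
move=> x0 xy; apply: Rmult_le_compat_r; first by left; apply/Rinv_0_lt_compat/ln2_gt0.
by case: xy => [xy|->]; [left; apply: ln_increasing | right].
Qed.

Lemma log2R_pow x n : 0 < x -> log2R (x ^ n) = INR n * log2R x.
Proof. by move=> x0; rewrite /log2R ln_pow // /Rdiv Rmult_assoc. Qed.

Lemma log2R_mult x y : 0 < x -> 0 < y -> log2R (x * y) = log2R x + log2R y.
Proof. by move=> x0 y0; rewrite /log2R ln_mult // Rdiv_plus_distr. Qed.

Lemma log2R_2 : log2R 2 = 1.
Proof. by rewrite /log2R /Rdiv Rinv_r //; have := ln2_gt0; lra. Qed.

Theorem theorem2 (q : nat -> nat)
  (hq : exists (C N : nat), forall n : nat, (N <= n)%N -> (q n <= C * n ^ 2)%N) :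
  exists c1 c2 : R, 0 < c1 /\ c1 <= c2 /\
    exists N : nat, forall n : nat, (N <= n)%N ->
      c1 * INR n * 2 ^ n / log2R (INR n) <= INR (L n (q n)) /\
      INR (L n (q n)) <= c2 * INR n * 2 ^ n / log2R (INR n).
Proof.
have [C [N0 hN]] := hq.
exists (/ 72), (24 * 1000); split; first lra; split; first lra.
(* The threshold [C + 2] ensures [n + q n + 1 <= (C + 2) * n ^ 2 <= n ^ 3]. *)
exists (maxn (2 ^ 12)%N (maxn N0 (C + 2))) => n.
rewrite !geq_max => /and3P[n12 nN nC].
have n0 : (4 <= n)%N by apply: leq_trans n12; rewrite -[4%N]/(2 ^ 2)%N leq_exp2l.
have rn : 4 <= INR n by have := INR_leq n0; rewrite [INR 4]/=; lra.
have lpos : 1 <= log2R (INR n) by rewrite -log2R_2; apply: log2R_le; lra.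
have P0 : 2 <= 2 ^ n.
  rewrite -{1}(pow_1 2); apply: Rle_pow; first lra.
  by apply/leP; apply: leq_trans n0.
set l := L n (q n); set lg := log2R (INR n) in lpos *.
have div x : x / lg * lg = x by rewrite /Rdiv Rmult_assoc Rinv_l; lra.
split; apply: (Rmult_le_reg_r lg); try lra; rewrite div.
- have low := L_lower_nat (q n) n12.
  have qn : ((n + q n).+1 <= n ^ 3)%N.
    have := hN n nN; rewrite !expnS expn0 muln1; nia.
  have {}low : (2 ^ (n.-1 * 2 ^ n.-1) <= 2 * n ^ (9 * l))%N.
    apply: leq_trans low _; rewrite leq_mul2l /= -/l.
    have -> : (n ^ (9 * l) = (n ^ 3) ^ (3 * l))%N by rewrite -expnM mulnA.
    by case: (posnP (3 * l)) => [->|l0]; rewrite ?expn0 // leq_exp2r.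
  have := INR_leq low; rewrite INR_muln !INR_expn -[INR 2]/2 => {}low.
  have nn : 0 < INR n ^ (9 * l) by apply: pow_lt; lra.
  have := log2R_le _ low; rewrite log2R_mult ?log2R_pow //; try lra.
  rewrite log2R_2 !INR_muln INR_expn -[INR 2]/2 -/lg [INR 9]/=.
  have nE : n.-1.+1 = n by rewrite prednK //; apply: leq_trans n0.
  have -> : INR n.-1 = INR n - 1 by rewrite -{2}nE S_INR; lra.
  have : 2 ^ n = 2 * 2 ^ n.-1 by rewrite -{1}nE.
  have h : 0 < 2 ^ (n.-1 * 2 ^ n.-1) by apply: pow_lt; lra.
  move=> e /(_ h); move: P0; rewrite e; set Q := 2 ^ n.-1 => Q1 le.
  (* The counting bound reads [(n - 1) * Q <= 1 + 9 * l * lg]; for [n >= 4] and [Q >= 1] it yields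
     [n * Q / 36 <= l * lg], which is the constant 1/72 because [2 ^ n = 2 * Q]. *)
  have : 0 <= (INR n - 4) * Q by apply: Rmult_le_pos; lra.
  lra.
- have [M nM lM] := @L_upper_nat n (q n) n12.
  have lgM : lg <= INR M.
    have := INR_leq nM; rewrite INR_expn -[INR 2]/2 => /log2R_le.
    by rewrite log2R_pow ?log2R_2; [rewrite Rmult_1_r; apply; lra | lra].
  have := INR_leq lM; rewrite !INR_muln INR_expn -[INR 2]/2 -/l.
  have -> : INR 1000 = 1000 by rewrite INR_IZR_INZ.
  have -> : INR 24 = 24 by rewrite INR_IZR_INZ.
  apply: Rle_trans; apply: Rmult_le_compat_l => //; exact: pos_INR.
Qed.
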